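(* For any $[0,1]$-category $\mathcal{C}$, the assignment $x\mapsto h^x:=\mathcal{C}(x,-)$ defines a $[0,1]$-enriched functor $\mathcal{C}^{\mathrm{op}}\to\widehat{\mathcal{C}}$, embedding $\mathcal{C}^{\mathrm{op}}$ as an enriched subcategory of $\widehat{\mathcal{C}}$, in the sense that $\mathcal{C}^{\mathrm{op}}(x,y)=\widehat{\mathcal{C}}(h^x,h^y)$ for all objects $x,y$ of $\mathcal{C}$.
   Context: The unit interval $[0,1]$ is a commutative monoidal preorder under $\le$ and multiplication, with internal hom $[a,b]:=b/a$ if $b<a$ and $[a,b]:=1$ otherwise. A $[0,1]$-category $\mathcal{C}$ is a set of objects with numbers $\mathcal{C}(x,y)\in[0,1]$ such that $\mathcal{C}(x,x)=1$ and $\mathcal{C}(y,z)\mathcal{C}(x,y)\le\mathcal{C}(x,z)$ for all $x,y,z$. The opposite $\mathcal{C}^{\mathrm{op}}$ has the same objects and $\mathcal{C}^{\mathrm{op}}(x,y)=\mathcal{C}(y,x)$. A $[0,1]$-enriched functor $F\colon\mathcal{C}\to\mathcal{D}$ is a function on objects with $\mathcal{C}(x,y)\le\mathcal{D}(Fx,Fy)$ for all $x,y$. A $[0,1]$-copresheaf on $\mathcal{C}$ is a function $f\colon\mathcal{C}\to[0,1]$ with $\mathcal{C}(x,y)\le[fx,fy]$ for all $x,y$. The $[0,1]$-category $\widehat{\mathcal{C}}$ of copresheaves has hom objects $\widehat{\mathcal{C}}(f,g)=\inf_{c\in\mathcal{C}}[fc,gc]$. *)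

(* Defs.v *)
From HB Require Import structures.
From mathcomp Require Import all_boot all_order all_algebra.
From mathcomp Require Import interval_inference.
From mathcomp Require Import boolp classical_sets reals.
Set Implicit Arguments.
Unset Strict Implicit.
Unset Printing Implicit Defensive.
Import Order.TTheory GRing.Theory Num.Theory.
Local Open Scope ring_scope.
Local Open Scope classical_set_scope.

(* [{i01 R}] is the real unit interval; its monoidal product is the product of
   the underlying reals. *)

Fact ihom_ge0 (R : realType) (a b : {i01 R}) :
  0 <= (if b%:num < a%:num then b%:num / a%:num else 1 : R).
Proof. by case: ifP. Qed.

Fact ihom_le1 (R : realType) (a b : {i01 R}) :
  (if b%:num < a%:num then b%:num / a%:num else 1 : R) <= 1.
Proof.
case: ifPn => // ba; have a0 : 0 < a%:num by apply: le_lt_trans ba.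
by rewrite ler_pdivrMr // mul1r ltW.
Qed.

Definition ihom (R : realType) (a b : {i01 R}) : {i01 R} :=
  Itv01 (ihom_ge0 a b) (ihom_le1 a b).

Lemma ihomP (R : realType) (a b : {i01 R}) (c : R) : c <= 1 ->
  (c * a%:num <= b%:num) = (c <= (ihom a b)%:num).
Proof.
move=> c1; rewrite /ihom /=; case: ltP => [ba|ab].
  by rewrite ler_pdivlMr //; apply: le_lt_trans ba.
by rewrite c1; apply: le_trans ab; rewrite ler_piMl.
Qed.

(* The infimum is taken in [0,1], so the empty family has infimum 1, whereas
   [inf set0 = 0] in the library; adjoining 1 changes nothing otherwise. *)
Definition inf01_val (R : realType) (I : Type) (f : I -> {i01 R}) : R :=
  inf ([set 1] `|` range (fun i => (f i)%:num)).

Fact inf01_ge0 (R : realType) (I : Type) (f : I -> {i01 R}) : 0 <= inf01_val f.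
Proof. by apply: lb_le_inf; [exists 1; left|move=> _ [->|[i _ <-]]]. Qed.

Fact inf01_has_lbound (R : realType) (I : Type) (f : I -> {i01 R}) :
  has_lbound ([set 1] `|` range (fun i => (f i)%:num)).
Proof. by exists 0 => _ [->|[i _ <-]]. Qed.

Fact inf01_le1 (R : realType) (I : Type) (f : I -> {i01 R}) : inf01_val f <= 1.
Proof. by apply: ge_inf; [exact: inf01_has_lbound|left]. Qed.

Definition inf01 (R : realType) (I : Type) (f : I -> {i01 R}) : {i01 R} :=
  Itv01 (inf01_ge0 f) (inf01_le1 f).

Lemma inf01P (R : realType) (I : Type) (f : I -> {i01 R}) (c : R) : c <= 1 ->
  c <= (inf01 f)%:num <-> forall i, c <= (f i)%:num.
Proof.
move=> c1; split=> [cf i|cf].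
  apply: le_trans cf _; apply: ge_inf; first exact: inf01_has_lbound.
  by right; exists i.
by apply: lb_le_inf; [exists 1; left|move=> _ [->|[i _ <-]]].
Qed.

Record ucat (R : realType) := UCat {
  uobj :> Type;
  uhom : uobj -> uobj -> {i01 R};
  uhom_id : forall x, (uhom x x)%:num = 1;
  uhom_comp : forall x y z,
    (uhom y z)%:num * (uhom x y)%:num <= (uhom x z)%:num }.
Arguments uhom {R} u _ _.

Record ufunctor (R : realType) (C D : ucat R) := UFunctor {
  ufun :> C -> D;
  ufun_le : forall x y, (uhom C x y)%:num <= (uhom D (ufun x) (ufun y))%:num }.

Record copresheaf (R : realType) (C : ucat R) := Copresheaf {
  copsh_fun :> C -> {i01 R};
  copsh_le : forall x y,
    (uhom C x y)%:num <= (ihom (copsh_fun x) (copsh_fun y))%:num }.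

Fact opcat_comp (R : realType) (C : ucat R) (x y z : C) :
  (uhom C z y)%:num * (uhom C y x)%:num <= (uhom C z x)%:num.
Proof. by rewrite mulrC uhom_comp. Qed.

Definition opcat (R : realType) (C : ucat R) : ucat R :=
  @UCat R C (fun x y => uhom C y x) (@uhom_id R C) (@opcat_comp R C).

Definition copsh_hom (R : realType) (C : ucat R) (f g : copresheaf C) :
  {i01 R} := inf01 (fun c => ihom (f c) (g c)).

Fact copsh_hom_id (R : realType) (C : ucat R) (f : copresheaf C) :
  (copsh_hom f f)%:num = 1.
Proof.
apply/eqP; rewrite eq_le; apply/andP; split; first by [].
by apply/inf01P => // c; rewrite -ihomP // mul1r.
Qed.

Fact copsh_hom_comp (R : realType) (C : ucat R) (f g h : copresheaf C) :
  (copsh_hom g h)%:num * (copsh_hom f g)%:num <= (copsh_hom f h)%:num.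
Proof.
have le (k l : copresheaf C) c : (copsh_hom k l)%:num * (k c)%:num <= (l c)%:num.
  by rewrite ihomP //; move: c; apply/inf01P.
have le1 : (copsh_hom g h)%:num * (copsh_hom f g)%:num <= 1 :> R.
  by rewrite mulr_ile1.
apply/inf01P => // c; rewrite -ihomP // -mulrA.
by apply: le_trans (le g h c); rewrite ler_wpM2l.
Qed.

Definition copshcat (R : realType) (C : ucat R) : ucat R :=
  @UCat R (copresheaf C) (@copsh_hom R C) (@copsh_hom_id R C)
    (@copsh_hom_comp R C).

(* Main.v *)
Require Import Defs.
From HB Require Import structures.
From mathcomp Require Import all_boot all_order all_algebra.
From mathcomp Require Import interval_inference.
From mathcomp Require Import boolp classical_sets reals.

(* The Yoneda argument: evaluating the infimum defining the hom from [h^x] to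
   [h^y] at [c = x], where [C(x,x) = 1], bounds it above by [C(y,x)], while
   composition in [C] shows that [C(y,x)] is a lower bound. *)

Import Order.TTheory GRing.Theory Num.Theory.
Local Open Scope ring_scope.

(** Transposed along the adjunction [ihomP], this is the composition law of [C]; it makes [uhom C x]
    a copresheaf. *)
Lemma uhom_le_ihom (R : realType) (C : ucat R) (x y z : C) :
  (uhom C y z)%:num <= (ihom (uhom C x y) (uhom C x z))%:num.
Proof. by rewrite -ihomP // uhom_comp. Qed.

Definition corepresentable {R : realType} {C : ucat R} (x : C) : copresheaf C :=
  Copresheaf (uhom_le_ihom R C x).

Lemma copsh_hom_corepresentable (R : realType) (C : ucat R) (x y : C) :
  copsh_hom (corepresentable x) (corepresentable y) = uhom C y x.
Proof.
set h := copsh_hom _ _.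
apply/val_inj/le_anti/andP; split.
  have h_le c : h%:num <= (ihom (uhom C x c) (uhom C y c))%:num.
    by move: c; apply/inf01P.
  by have := h_le x; rewrite -ihomP // uhom_id mulr1.
change ((uhom C y x)%:num <= h%:num).
(* After transposition: composition along [y], [x], [c], whose law has the two factors in the other
   order. *)
by apply/inf01P => // c; rewrite -ihomP // mulrC uhom_comp.
Qed.

(** Holds as an equality, since [uhom (opcat C) x y] is by definition [uhom C y x]. *)
Lemma corepresentable_le (R : realType) (C : ucat R) (x y : opcat C) :
  (uhom (opcat C) x y)%:num <=
  (uhom (copshcat C) (@corepresentable R C x) (@corepresentable R C y))%:num.
Proof. by rewrite [uhom (copshcat C) _ _]copsh_hom_corepresentable. Qed.

Theorem corollary2 (R : realType) (C : ucat R) :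
  exists h : ufunctor (opcat C) (copshcat C),
    (forall x c : C, copsh_fun (h x) c = uhom C x c) /\
    (forall x y : C, uhom (opcat C) x y = uhom (copshcat C) (h x) (h y)).
Proof.
exists (UFunctor (corepresentable_le R C)); split=> // x y.
exact/esym/copsh_hom_corepresentable.
Qed.
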